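(* The category of connected preordered commutative monoids is a torsion subcategory of the category of preordered commutative monoids. The corresponding torsion-free subcategory consists of those preordered commutative monoids whose connected component containing $0$ is trivial (i.e. equal to $\{0\}$).
   Context: A preordered commutative monoid is a commutative monoid (written additively) equipped with a preorder (reflexive transitive relation) $\le$ compatible with addition; morphisms are monotone monoid homomorphisms. Two elements $x,x'$ of a preordered commutative monoid $M$ are connected if there is a finite zigzag $x=x_0\le x_1\ge x_2\le\dots\ge x_n=x'$ with $x_0,\dots,x_n\in M$. This is an equivalence relation whose classes are the connected components of $M$. $M$ is connected if any two of its elements are connected. Subcategories are full. A torsion theory on a pointed category is a pair $(\mathcal T,\mathcal F)$ of full replete subcategories such that every morphism $A\to B$ with $A\in\mathcal T$ and $B\in\mathcal F$ is zero, and for every object $X$ there is a short exact sequence $A\xrightarrow{k} X\xrightarrow{q} B$ ($k$ is the kernel of $q$ and $q$ is the cokernel of $k$) with $A\in\mathcal T$ and $B\in\mathcal F$. $\mathcal T$ is a torsion subcategory if there is an $\mathcal F$ such that $(\mathcal T,\mathcal F)$ is a torsion theory; then $\mathcal F$ is uniquely determined and is the corresponding torsion-free subcategory. *)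

(* Defs.v *)
From Stdlib Require Import Relation_Definitions.
From mathcomp Require Import all_boot all_algebra.
From mathcomp Require Import boolp classical_sets.

Set Implicit Arguments.
Unset Strict Implicit.
Unset Printing Implicit Defensive.

Import GRing.Theory.
Local Open Scope ring_scope.

Record category := Category {
  ob :> Type;
  hom : ob -> ob -> Type;
  idmap : forall A, hom A A;
  comp : forall A B C, hom B C -> hom A B -> hom A C;
  comp1m : forall A B (f : hom A B), comp (idmap B) f = f;
  compm1 : forall A B (f : hom A B), comp f (idmap A) = f;
  compA : forall A B C D (h : hom C D) (g : hom B C) (f : hom A B),
    comp h (comp g f) = comp (comp h g) f
}.

Arguments hom {c} A B.
Arguments idmap {c} A.
Arguments comp {c A B C} g f.

Definition isomorphic (C : category) (A B : C) : Prop :=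
  exists (f : hom A B) (g : hom B A), comp g f = idmap A /\ comp f g = idmap B.

Definition zero_object (C : category) (Z : C) : Prop :=
  (forall A : C, exists! f : hom A Z, True) /\
  (forall A : C, exists! f : hom Z A, True).

Record pointedCategory := PointedCategory {
  pointed_cat :> category;
  zero_ob : pointed_cat;
  zero_obP : zero_object zero_ob
}.

Section TorsionTheory.
Context (C : pointedCategory).
Implicit Types (A B X Y : C) (T F : C -> Prop).

Definition zero_morphism A B (f : hom A B) : Prop :=
  exists (u : hom A (zero_ob C)) (v : hom (zero_ob C) B), f = comp v u.

Definition is_kernel A X B (k : hom A X) (q : hom X B) : Prop :=
  zero_morphism (comp q k) /\
  forall Y (f : hom Y X), zero_morphism (comp q f) ->
    exists! g : hom Y A, comp k g = f.

Definition is_cokernel A X B (q : hom X B) (k : hom A X) : Prop :=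
  zero_morphism (comp q k) /\
  forall Y (f : hom X Y), zero_morphism (comp f k) ->
    exists! g : hom B Y, comp g q = f.

Definition short_exact A X B (k : hom A X) (q : hom X B) : Prop :=
  is_kernel k q /\ is_cokernel q k.

(* A full subcategory is given by its class of objects. *)
Definition replete T : Prop := forall A B, isomorphic A B -> T A -> T B.

Definition torsion_theory T F : Prop :=
  [/\ replete T,
      replete F,
      (forall A B (f : hom A B), T A -> F B -> zero_morphism f)
    & (forall X, exists A B (k : hom A X) (q : hom X B),
        [/\ T A, F B & short_exact k q])].

Definition torsion_subcategory T : Prop := exists F, torsion_theory T F.

End TorsionTheory.

(* The choice structure carried by [nmodType] is no restriction: classically
   every type has one ([boolp.gen_eqMixin], [boolp.gen_choiceMixin]), and it
   plays no role in morphisms. *)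
Record pcmon := PCMon {
  pcmon_sort :> nmodType;
  pcle : relation pcmon_sort;
  pcle_preorder : preorder pcmon_sort pcle;
  pcle_add : forall x y z, pcle x y -> pcle (x + z) (y + z)
}.

Arguments pcle {p} x y.

Record pcmon_hom (A B : pcmon) := PCMonHom {
  pcmon_fun :> {additive A -> B};
  pcmon_fun_mono : forall x y : A, pcle x y -> pcle (pcmon_fun x) (pcmon_fun y)
}.

Lemma pcmon_hom_eq (A B : pcmon) (f g : pcmon_hom A B) : f =1 g -> f = g.
Proof.
case: f g => [f fle] [g gle] /= fg.
have {}fg : f = g.
  case: f g {fle gle} fg => [f [[fD]]] [g [[gD]]] /= /funext fg.
  by subst g; rewrite (Prop_irrelevance fD gD).
by subst g; rewrite (Prop_irrelevance fle gle).
Qed.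

Definition pcmon_id (A : pcmon) : pcmon_hom A A :=
  @PCMonHom A A (idfun : {additive A -> A}) (fun _ _ le_xy => le_xy).

Definition pcmon_comp (A B C : pcmon) (g : pcmon_hom B C) (f : pcmon_hom A B) :
    pcmon_hom A C :=
  @PCMonHom A C ((g \o f : A -> C) : {additive A -> C})
    (fun _ _ le_xy => pcmon_fun_mono g (pcmon_fun_mono f le_xy)).

Definition pcmon_category : category.
Proof.
refine (@Category pcmon pcmon_hom pcmon_id pcmon_comp _ _ _).
- by move=> A B f; apply: pcmon_hom_eq.
- by move=> A B f; apply: pcmon_hom_eq.
- by move=> A B C D h g f; apply: pcmon_hom_eq.
Defined.

(* The additive group on ['I_1] is the one-element monoid. *)
Definition pcmon_zero : pcmon.
Proof.
refine (@PCMon 'I_1 (fun _ _ => True) _ (fun _ _ _ _ => I)).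
by split.
Defined.

Lemma pcmon_zeroP : @zero_object pcmon_category pcmon_zero.
Proof.
split=> A.
- exists (@PCMonHom A pcmon_zero (\0 : {additive A -> 'I_1})
    (fun _ _ _ => I)); split=> // f _.
  by apply: pcmon_hom_eq => x; rewrite !ord1.
- have mono0 (x y : pcmon_zero) :
      pcle x y -> pcle ((\0 : {additive 'I_1 -> A}) x)
                       ((\0 : {additive 'I_1 -> A}) y).
    by move=> _; apply: (preord_refl _ _ (pcle_preorder A)).
  exists (@PCMonHom pcmon_zero A (\0 : {additive 'I_1 -> A}) mono0).
  split=> // f _.
  by apply: pcmon_hom_eq => x; rewrite [x]ord1 !raddf0.
Qed.

Definition PCMonCat : pointedCategory := PointedCategory pcmon_zeroP.

(* The zigzag [w 0 <= w 1 >= w 2 <= ... >= w n.*2] in [M]. *)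
Definition connected (M : pcmon) (x y : M) : Prop :=
  exists (n : nat) (w : nat -> M),
    [/\ w 0%N = x, w n.*2 = y
      & forall i, (i < n)%N ->
          pcle (w i.*2) (w i.*2.+1) /\ pcle (w i.*2.+2) (w i.*2.+1)].

Definition connected_component (M : pcmon) (x : M) : set M :=
  [set y | connected x y]%classic.

Definition connected_pcmon (M : pcmon) : Prop :=
  forall x y : M, connected x y.

Definition trivial_zero_component (M : pcmon) : Prop :=
  connected_component (0 : M) = [set 0]%classic.

(* Main.v *)
From HB Require Import structures.
From Stdlib Require Import Relation_Definitions Relation_Operators.
From Stdlib Require Import Operators_Properties.
From mathcomp Require Import all_boot all_algebra.
From mathcomp Require Import boolp classical_sets.
Require Import Defs.

Set Implicit Arguments.
Unset Strict Implicit.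
Unset Printing Implicit Defensive.

Import GRing.Theory.
Local Open Scope ring_scope.
Local Open Scope quotient_scope.

(** Let [X] be a preordered commutative monoid and [C] the connected component
    of [0] in it. Connectedness is compatible with addition, so [C] is a
    submonoid, and since a zigzag between points of [C] stays in [C], it is
    connected for the induced preorder. The torsion decomposition of [X] is

      C --> X --> X / C

    where [x] and [y] agree in [X / C] when [x + a = y + b] for some [a], [b]
    in [C], and the preorder is the image of that of [X].

    For any submonoid [S] the projection [X --> X / S] is the cokernel of the
    inclusion ([quot_proj_cokernel]). The elements it kills are the [x] with
    [x + a] in [S] for some [a] in [S], so the inclusion is its kernel as soon
    as such [x] lie in [S] ([sub_incl_kernel]). This holds for [C], because
    [x] is connected to [x + a] whenever [a] is connected to [0]; for the same
    reason passing to [X / C] identifies only connected elements, so zigzags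
    in [X / C] come from connected elements of [X] ([quot_connected]), and
    the component of [0] in [X / C] is trivial. Finally, a morphism maps
    connected elements to connected elements, hence is zero if its source is
    connected and the component of [0] in its target is trivial.

    The torsion-free class is determined by the torsion class in every pointed
    category: its objects are those receiving only zero morphisms from torsion
    objects ([torsion_freeP]). So it is enough to exhibit one torsion
    theory. *)

(** * Torsion-free objects in a pointed category *)

Section PointedCategory.
Context (C : pointedCategory).
Implicit Types (A B X Y : C) (T F : C -> Prop).

Lemma zero_morphism_compl A B X (g : hom B X) (f : hom A B) :
  zero_morphism f -> zero_morphism (comp g f).
Proof. by move=> [u [v ->]]; exists u, (comp g v); rewrite compA. Qed.

(** If [k] is zero then the identity of [X] kills it, so it factors through [q]
    as [g q]. Then [q g q = q], and uniqueness of factorizations through [q]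
    yields that [q g] is the identity too. *)
Lemma cokernel_zero_iso A X B (k : hom A X) (q : hom X B) :
  zero_morphism k -> is_cokernel q k -> isomorphic B X.
Proof.
move=> k0 [qk0 q_univ].
have [g [gq _]] := q_univ _ (idmap X) (zero_morphism_compl (idmap X) k0).
exists g, q; split=> //.
have [h [_ h_uniq]] := q_univ _ q qk0.
by rewrite -(h_uniq (comp q g)) ?(h_uniq (idmap B)) ?comp1m // -compA gq compm1.
Qed.

(** Uniqueness of the torsion-free class: in the decomposition of an object that
    receives only zero morphisms from [T], the torsion part maps by zero, so
    the object is isomorphic to its torsion-free quotient. *)
Lemma torsion_freeP T F : torsion_theory T F ->
  forall X, F X <-> forall A (f : hom A X), T A -> zero_morphism f.
Proof.
move=> [_ F_replete TF0 dec] X; split=> [FX A f TA | X_free]; first exact: TF0.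
have [A [B [k [q [TA FB [_ q_coker]]]]]] := dec X.
exact: F_replete (cokernel_zero_iso (X_free _ k TA) q_coker) FB.
Qed.

End PointedCategory.

(** * Connectedness in preordered commutative monoids *)

Lemma pcle_refl (M : pcmon) (x : M) : pcle x x.
Proof. exact: (preord_refl _ _ (pcle_preorder M)). Qed.

Lemma pcle_trans (M : pcmon) (x y z : M) : pcle x y -> pcle y z -> pcle x z.
Proof. exact: (preord_trans _ _ (pcle_preorder M)). Qed.

Lemma pcmon_zero_morphismP (A B : PCMonCat) (f : hom A B) :
  zero_morphism f <-> forall x, (f : pcmon_hom A B) x = 0.
Proof.
split=> [[u [v ->]] x /= | f0].
  by rewrite [pcmon_fun u x]ord1 raddf0.
have [u _] := pcmon_zeroP.1 A; have [v _] := pcmon_zeroP.2 B.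
exists u, v; apply: pcmon_hom_eq => x /=.
by rewrite f0 [pcmon_fun u x]ord1 raddf0.
Qed.

Section Connected.
Variable M : pcmon.
Implicit Types x y z : M.

(** A single comparison fits the rigid up-then-down shape of zigzags by
    repeating its upper end. *)
Lemma connected_step x y z :
  pcle x y \/ pcle y x -> connected y z -> connected x z.
Proof.
move=> xy [n [w [w0 wn w_zigzag]]].
have [t [xt yt]] : exists t, pcle x t /\ pcle y t.
  by case: xy; [exists y | exists x]; split=> //; apply: pcle_refl.
exists n.+1, (fun i => if i is i'.+1 then if i' is j.+1 then w j else t else x).
split=> // -[|i] /=; first by rewrite w0.
exact: w_zigzag.
Qed.

(** The equivalence closure gives an induction principle free of indices, on
    which the facts below rely. *)
Lemma connectedP x y :
  connected x y <-> clos_refl_sym_trans M (@pcle M) x y.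
Proof.
split=> [[n [w [<- <- {x y}]]] | /clos_rst_rst1n_iff].
  elim: n => [|n IHn] w_zigzag; first exact: rst_refl.
  have [le1 le2] := w_zigzag n (ltnSn n).
  apply: rst_trans (IHn _) _ => [i /ltnW|]; first exact: w_zigzag.
  apply: rst_trans (rst_step _ _ _ _ le1) _.
  exact/rst_sym/rst_step.
elim=> {x y} [x | x y z xy _]; last exact: connected_step.
by exists 0%N, (fun=> x).
Qed.

Lemma connected_refl x : connected x x.
Proof. exact/connectedP/rst_refl. Qed.

Lemma connected_sym x y : connected x y -> connected y x.
Proof. by move=> /connectedP xy; apply/connectedP/rst_sym. Qed.

Lemma connected_trans x y z : connected x y -> connected y z -> connected x z.
Proof.
by move=> /connectedP xy /connectedP yz; apply/connectedP/(rst_trans _ _ _ y).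
Qed.

Lemma pcle_connected x y : pcle x y -> connected x y.
Proof. by move=> ?; apply/connectedP/rst_step. Qed.

Lemma connectedDr z x y : connected x y -> connected (x + z) (y + z).
Proof.
move=> /connectedP; elim=> {x y} [x y xy | x | x y _ | x y t _ xy _].
- exact/pcle_connected/pcle_add.
- exact: connected_refl.
- exact: connected_sym.
- exact: connected_trans.
Qed.

End Connected.

Lemma connected_hom (A B : pcmon) (f : pcmon_hom A B) x y :
  connected x y -> connected (f x) (f y).
Proof.
move=> [n [w [<- <- w_zigzag]]]; exists n, (f \o w); split=> // i i_lt_n.
by have [? ?] := w_zigzag i i_lt_n; split; apply: pcmon_fun_mono.
Qed.

Lemma isomorphic_retract (A B : PCMonCat) : isomorphic A B ->
  exists (f : pcmon_hom A B) (g : pcmon_hom B A), cancel g f.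
Proof.
move=> [f [g [_ fg]]]; exists f, g => x.
by have := congr1 (fun h : pcmon_hom B B => h x) fg.
Qed.

(** * The submonoid and quotient of a preordered commutative monoid *)

Section Submonoid.
Variables (X : pcmon) (S : addrClosed X).

Record submonoid := Submonoid {
  submonoid_val : X;
  _ : submonoid_val \in S
}.

HB.instance Definition _ := [isSub for submonoid_val].
HB.instance Definition _ := [Choice of submonoid by <:].

Fact submonoid_closed : addr_closed [pred x : X | x \in S].
Proof. by split=> [|x y]; [apply: rpred0 | apply: rpredD]. Qed.

HB.instance Definition _ :=
  GRing.SubChoice_isSubNmodule.Build X _ submonoid submonoid_closed.

Definition sub_le (u v : submonoid) := pcle (val u) (val v).

Definition sub_pcmon : pcmon.
Proof.
refine (@PCMon submonoid sub_le _ _).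
- by split=> [u | u v w]; [apply: pcle_refl | apply: pcle_trans].
- by move=> u v w uv; rewrite /sub_le !raddfD; apply: pcle_add.
Defined.

Definition sub_incl : pcmon_hom sub_pcmon X :=
  @PCMonHom sub_pcmon X (val : {additive submonoid -> X}) (fun _ _ uv => uv).

(** The congruence generated by [a ~ 0] for [a] in [S]; the correction terms
    appear on both sides since there is no subtraction. *)
Definition quot_rel (x y : X) : Prop :=
  exists a b, [/\ a \in S, b \in S & x + a = y + b].

Definition quot_relb (x y : X) := `[< quot_rel x y >].

Lemma quot_relb_equiv : equiv_class_of quot_relb.
Proof.
split=> [x | x y | y x z].
- by apply/asboolP; exists 0, 0; rewrite !rpred0.
- by apply/asboolP/asboolP => -[a [b [? ? ?]]]; exists b, a.
- move=> /asboolP[a [b [aS bS xy]]] /asboolP[c [d [cS dS yz]]].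
  apply/asboolP; exists (a + c), (d + b); rewrite !rpredD //; split=> //.
  by rewrite addrA xy addrAC yz addrA.
Qed.

Canonical quot_equiv := EquivRelPack quot_relb_equiv.

Definition quotient := {eq_quot quot_equiv}.
HB.instance Definition _ := Choice.on quotient.
HB.instance Definition _ := EqQuotient.on quotient.

Lemma quot_eqP (x y : X) : \pi_quotient x = \pi_quotient y <-> quot_rel x y.
Proof. by split=> [/eqmodP/asboolP | xy]; last exact/eqmodP/asboolP. Qed.

Lemma quotDr (x a : X) : a \in S -> \pi_quotient (x + a) = \pi_quotient x.
Proof. by move=> aS; apply/quot_eqP; exists 0, a; rewrite rpred0 addr0. Qed.

Definition quot_add (u v : quotient) : quotient :=
  \pi_quotient (repr u + repr v).

Lemma quot_addE x y :
  quot_add (\pi_quotient x) (\pi_quotient y) = \pi_quotient (x + y).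
Proof.
apply/quot_eqP.
have /quot_eqP[a [b [aS bS xE]]] := reprK (\pi_quotient x).
have /quot_eqP[c [d [cS dS yE]]] := reprK (\pi_quotient y).
exists (a + c), (b + d); rewrite !rpredD //; split=> //.
by rewrite addrACA xE yE addrACA.
Qed.

Lemma quot_addA : associative quot_add.
Proof.
move=> u v w; elim/quotW: u => x; elim/quotW: v => y; elim/quotW: w => z.
(* Left to unification, [quot_addE] can also match by unfolding [quot_add]
   into a [\pi_quotient], so the two inner sums are rewritten by hand. *)
by rewrite (quot_addE y z) (quot_addE x y) !quot_addE addrA.
Qed.

Lemma quot_addC : commutative quot_add.
Proof.
move=> u v; elim/quotW: u => x; elim/quotW: v => y.
by rewrite !quot_addE addrC.
Qed.

Lemma quot_add0 : left_id (\pi_quotient 0) quot_add.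
Proof. by move=> u; elim/quotW: u => x; rewrite quot_addE add0r. Qed.

HB.instance Definition _ :=
  GRing.isNmodule.Build quotient quot_addA quot_addC quot_add0.

(** The image of the preorder is already transitive: between
    [x <= y] and [y' <= z] with [y + a = y' + b], adding [a] to the first and
    [b] to the second makes them composable without changing the classes of
    [x] and [z]. *)
Definition quot_le (u v : quotient) : Prop :=
  exists x y, [/\ u = \pi_quotient x, v = \pi_quotient y & pcle x y].

Definition quot_pcmon : pcmon.
Proof.
refine (@PCMon quotient quot_le _ _).
- split=> [u | u v w].
    by exists (repr u), (repr u); rewrite reprK; split=> //; apply: pcle_refl.
  move=> [x [y [-> -> xy]]] [y' [z [/quot_eqP[a [b [aS bS yE]]] -> yz]]].
  exists (x + a), (z + b); rewrite !quotDr //; split=> //.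
  by apply: pcle_trans (pcle_add a xy) _; rewrite yE; apply: pcle_add.
- move=> u v w; elim/quotW: w => z [x [y [-> -> xy]]].
  by exists (x + z), (y + z); split; [exact: quot_addE.. | exact: pcle_add].
Defined.

Definition quot_proj_fun (x : X) : quotient := \pi_quotient x.

Lemma quot_proj_nmod : nmod_morphism quot_proj_fun.
Proof. by split=> // x y; rewrite [RHS]quot_addE. Qed.

HB.instance Definition _ :=
  GRing.isNmodMorphism.Build X quotient quot_proj_fun quot_proj_nmod.

Lemma quot_proj_mono (x y : X) :
  pcle x y -> quot_le (quot_proj_fun x) (quot_proj_fun y).
Proof. by exists x, y. Qed.

Definition quot_proj : pcmon_hom X quot_pcmon :=
  @PCMonHom X quot_pcmon (quot_proj_fun : {additive X -> quotient})
    quot_proj_mono.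

Lemma quot_proj_eq0 x : quot_proj x = 0 <->
  exists2 a, a \in S & x + a \in S.
Proof.
rewrite -(raddf0 quot_proj); split=> [/quot_eqP[a [b [aS bS xE]]] | [a aS xaS]].
  by exists a; rewrite // xE add0r.
by apply/quot_eqP; exists a, (x + a); rewrite add0r.
Qed.

(** A morphism vanishing on [S] takes the same value on [x] and [y] when
    [x + a = y + b] with [a] and [b] in [S], so it descends to the quotient. *)
Lemma quot_proj_cokernel :
  @is_cokernel PCMonCat sub_pcmon X quot_pcmon quot_proj sub_incl.
Proof.
split=> [|Y f /pcmon_zero_morphismP f0].
  apply/pcmon_zero_morphismP => u; apply/quot_proj_eq0.
  by exists 0; rewrite ?rpred0 // addr0 (valP u).
have fS a : a \in S -> (f : pcmon_hom X Y) a = 0.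
  by move=> aS; apply: (f0 (Submonoid aS)).
pose g (u : quot_pcmon) := (f : pcmon_hom X Y) (repr (u : quotient)).
have gE x : g (\pi_quotient x) = (f : pcmon_hom X Y) x.
  have /quot_eqP[a [b [aS bS xE]]] := reprK (\pi_quotient x).
  by rewrite /g -[LHS]addr0 -(fS a aS) -raddfD xE raddfD (fS b bS) addr0.
have g_nmod : nmod_morphism g.
  split; first by rewrite [LHS]gE raddf0.
  move=> u v; elim/quotW: u => x; elim/quotW: v => y.
  by rewrite [X in g X](quot_addE x y) !gE raddfD.
have g_mono u v : pcle u v -> pcle (g u) (g v).
  by move=> [x [y [-> -> xy]]]; rewrite !gE; apply: pcmon_fun_mono.
pose gA := GRing.isNmodMorphism.Build quot_pcmon Y g g_nmod.
pose gM : {additive quot_pcmon -> Y} := HB.pack g gA.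
exists (@PCMonHom quot_pcmon Y gM g_mono); split.
  by apply: pcmon_hom_eq => x; apply: gE.
move=> h hq; apply: pcmon_hom_eq => u; elim/quotW: u => x.
by rewrite [LHS]gE -hq.
Qed.

(** Under the cancellation hypothesis the elements killed by the projection are
    exactly those of [S], so morphisms killed by it corestrict to [S]. *)
Lemma sub_incl_kernel :
  (forall x a, a \in S -> x + a \in S -> x \in S) ->
  @is_kernel PCMonCat sub_pcmon X quot_pcmon sub_incl quot_proj.
Proof.
move=> S_cancel; split=> [|Y f /pcmon_zero_morphismP qf0].
  exact: quot_proj_cokernel.1.
have fS y : (f : pcmon_hom Y X) y \in S.
  by have /quot_proj_eq0[a aS] := qf0 y; apply: S_cancel.
pose g (y : (Y : pcmon)) : sub_pcmon := Submonoid (fS y).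
have g_nmod : nmod_morphism g.
  by split=> [|x y]; apply: val_inj; rewrite /= ?raddf0 ?raddfD.
have g_mono x y : pcle x y -> pcle (g x) (g y).
  by move=> xy; apply: (pcmon_fun_mono f xy).
pose gA := GRing.isNmodMorphism.Build Y sub_pcmon g g_nmod.
pose gM : {additive Y -> sub_pcmon} := HB.pack g gA.
exists (@PCMonHom Y sub_pcmon gM g_mono); split.
  exact: pcmon_hom_eq.
by move=> h hf; apply: pcmon_hom_eq => y; apply: val_inj; rewrite /= -hf.
Qed.

End Submonoid.

(** * The connected component of zero *)

Section ZeroComponent.
Variable X : pcmon.

Definition zero_component : {pred X} := fun x => `[< connected 0 x >].

Lemma zero_componentP x : reflect (connected 0 x) (x \in zero_component).
Proof. exact: asboolP. Qed.

(** Translate a zigzag from [0] to [a] by [x]. All properties of the component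
    of [0] and of its quotient come down to this. *)
Lemma zero_component_connectedDr x a : a \in zero_component ->
  connected x (x + a).
Proof.
by move=> /zero_componentP /(connectedDr x); rewrite add0r addrC.
Qed.

Lemma zero_component_closed : addr_closed zero_component.
Proof.
split=> [|x y /zero_componentP x0 yC]; apply/zero_componentP.
  exact: connected_refl.
exact: connected_trans x0 (zero_component_connectedDr x yC).
Qed.

HB.instance Definition _ :=
  GRing.isAddClosed.Build X zero_component zero_component_closed.

Lemma zero_component_cancel x a :
  a \in zero_component -> x + a \in zero_component -> x \in zero_component.
Proof.
move=> aC /zero_componentP xaC; apply/zero_componentP.
exact: connected_trans xaC (connected_sym (zero_component_connectedDr x aC)).
Qed.

(** A zigzag in [X] between elements of the component of [0] never leaves that
    component, so it is a zigzag for the induced preorder. *)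
Lemma zero_component_connected : connected_pcmon (sub_pcmon zero_component).
Proof.
suff sub_conn (x y : X) : connected x y ->
    forall (xC : x \in zero_component) (yC : y \in zero_component),
      @connected (sub_pcmon zero_component) (Submonoid xC) (Submonoid yC).
  move=> [x xC] [y yC]; apply: sub_conn.
  apply: connected_trans (connected_sym _) _; exact/zero_componentP.
move=> /connectedP; elim=> {x y} [x y xy | x | x y _ IH | x y z xy IHxy _ IHyz].
- by move=> xC yC; apply: pcle_connected.
- by move=> xC xC'; rewrite (bool_irrelevance xC xC'); apply: connected_refl.
- by move=> xC yC; apply/connected_sym/IH.
- move=> xC zC; have yC : y \in zero_component.
    apply/zero_componentP.
    by apply: connected_trans (zero_componentP _ xC) _; apply/connectedP.
  exact: connected_trans (IHxy xC yC) (IHyz yC zC).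
Qed.

(** The projection reflects connectedness: its fibres consist of connected
    elements, and comparisons in the quotient lift to comparisons in [X]. *)
Lemma quot_connected (x y : X) :
  connected (quot_proj zero_component x) (quot_proj zero_component y) ->
  connected x y.
Proof.
have fiber (s t : X) :
    quot_proj zero_component s = quot_proj zero_component t -> connected s t.
  move=> /quot_eqP[a [b [aC bC st]]].
  apply: connected_trans (zero_component_connectedDr s aC) _.
  by rewrite st; apply/connected_sym/zero_component_connectedDr.
have repr_proj (s : X) : connected (repr (\pi_(quotient zero_component) s)) s.
  by apply: fiber; apply: reprK.
(* Zigzags in the quotient pass through arbitrary classes, so the induction is
   carried out on canonical representatives. *)
move=> /connectedP quot_xy.
apply: connected_trans (connected_sym (repr_proj x)) _.
apply: connected_trans _ (repr_proj y).
elim: quot_xy => {x y} [u v [x [y [-> -> xy]]] | u | u v _ | u v w _ uv _].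
- apply: connected_trans (repr_proj x) _.
  exact: connected_trans (pcle_connected xy) (connected_sym (repr_proj y)).
- exact: connected_refl.
- exact: connected_sym.
- exact: connected_trans.
Qed.

Lemma quot_trivial_zero_component :
  trivial_zero_component (quot_pcmon zero_component).
Proof.
apply/seteqP; split=> [u|u -> /=]; last exact: connected_refl.
elim/quotW: u => x; rewrite /connected_component /= => qx.
apply/quot_proj_eq0; exists 0; rewrite ?rpred0 // addr0.
apply/zero_componentP/quot_connected.
by rewrite raddf0.
Qed.

End ZeroComponent.

Arguments zero_component : clear implicits.

(** * The torsion theory *)

Lemma trivial_zero_componentP (M : pcmon) :
  trivial_zero_component M <-> forall x : M, connected 0 x -> x = 0.
Proof.
split=> [M0 x x0 | M0].
  by have : connected_component (0 : M) x by []; rewrite M0.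
by apply/seteqP; split=> [x /M0 | x ->] //; apply: connected_refl.
Qed.

Lemma connected_trivial_hom0 (A B : PCMonCat) (f : hom A B) :
  connected_pcmon A -> trivial_zero_component B -> zero_morphism f.
Proof.
move=> A_conn /trivial_zero_componentP B0; apply/pcmon_zero_morphismP => x.
by apply: B0; rewrite -(raddf0 (f : pcmon_hom A B)); apply: connected_hom.
Qed.

Lemma connected_torsion_theory :
  @torsion_theory PCMonCat connected_pcmon trivial_zero_component.
Proof.
split=> [A B /isomorphic_retract[f [g fgK]] A_conn x y
        | A B /isomorphic_retract[f [g fgK]] /trivial_zero_componentP A0
        | | X].
- by rewrite -(fgK x) -(fgK y); apply: connected_hom.
- apply/trivial_zero_componentP => x /(connected_hom g).
  by rewrite raddf0 => /A0 gx0; rewrite -(fgK x) gx0 raddf0.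
- exact: connected_trivial_hom0.
pose C := zero_component X.
exists (sub_pcmon C), (quot_pcmon C), (sub_incl C), (quot_proj C); split.
- exact: zero_component_connected.
- exact: quot_trivial_zero_component.
- split; last exact: quot_proj_cokernel.
  exact/sub_incl_kernel/zero_component_cancel.
Qed.

Theorem proposition7p6 :
  @torsion_subcategory PCMonCat connected_pcmon /\
  forall F : PCMonCat -> Prop,
    @torsion_theory PCMonCat connected_pcmon F ->
    forall M : PCMonCat, F M <-> trivial_zero_component M.
Proof.
split=> [|F F_tt M].
  by exists trivial_zero_component; apply: connected_torsion_theory.
exact: iff_trans (torsion_freeP F_tt M)
  (iff_sym (torsion_freeP connected_torsion_theory M)).
Qed.
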